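(* The functor $Ext_g\circ S_g:\mathbf{Graded\ Frm}^{op}\longrightarrow\mathbf{Graded\ Fuzzy\ Top}$ is the right adjoint to the functor $fm_g\circ J_g:\mathbf{Graded\ Fuzzy\ Top}\longrightarrow\mathbf{Graded\ Frm}^{op}$.
   Context: Conventions. On $[0,1]$, $\wedge$ is minimum; infima and suprema of grades are taken in $[0,1]$. The Gödel arrow is $a\rightarrow b=1$ if $a\le b$ and $a\rightarrow b=b$ if $a>b$, for $a,b\in[0,1]$. A fuzzy subset of a set $X$ is a map $X\to[0,1]$. Spaces. A fuzzy topological space with graded inclusion $(X,\tau,\subseteq)$ is a set $X$ with a collection $\tau$ of fuzzy subsets of $X$ containing the constants $\tilde\emptyset=0$ and $\tilde X=1$, closed under arbitrary pointwise suprema (written $\bigcup$) and binary pointwise minima (written $\cap$), together with the fuzzy inclusion relation $gr(\tilde T_1\subseteq\tilde T_2)=\inf_{x\in X}\{\tilde T_1(x)\rightarrow\tilde T_2(x)\}$. The category $\mathbf{Graded\ Fuzzy\ Top}$ has these as objects; a morphism $f:(X,\tau,\subseteq)\to(Y,\tau',\subseteq)$ is a function $f:X\to Y$ such that $f^{-1}(\tilde T')\in\tau$ for all $\tilde T'\in\tau'$, where $f^{-1}(\tilde T')(x)=\tilde T'(f(x))$. Composition and identities are those of functions. Graded frames. A graded frame $(A,R)$ is a tuple $(A,\top,\wedge,\bigvee,R)$ with $A$ a non-empty set, $\top\in A$, $\wedge$ a binary operation on $A$, $\bigvee$ an operation on arbitrary subsets of $A$, and $R:A\times A\to[0,1]$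 a fuzzy relation, such that for all $a,b,c\in A$, $S\subseteq A$: (1) $R(a,a)=1$; (2) $R(a,b)=1=R(b,a)$ implies $a=b$; (3) $R(a,b)\wedge R(b,c)\le R(a,c)$; (4) $R(a\wedge b,a)=1=R(a\wedge b,b)$; (5) $R(a,\top)=1$; (6) $R(a,b)\wedge R(a,c)=R(a,b\wedge c)$; (7) $R(a,\bigvee S)=1$ if $a\in S$; (8) $\inf\{R(a,b)\mid a\in S\}=R(\bigvee S,b)$; (9) $R(a\wedge\bigvee S,\bigvee\{a\wedge b\mid b\in S\})=1$. A graded frame homomorphism $f:(A,R)\to(B,R')$ is a map $f:A\to B$ with (i) $f(a_1\wedge a_2)=f(a_1)\wedge f(a_2)$; (ii) $f(\bigvee_i a_i)=\sup_i\{f(a_i)\}$, where $\sup$ is the join in $B$; (iii) $R(a_1,a_2)\le R'(f(a_1),f(a_2))$. $\mathbf{Graded\ Frm}$ is the category of graded frames and graded frame homomorphisms; $\mathbf{Graded\ Frm}^{op}$ is its opposite. Systems. A graded fuzzy topological system $(X,\models,A,R)$ consists of a nonempty set $X$, a graded frame $(A,R)$ and a fuzzy relation $\models$ from $X$ to $A$, with values $gr(x\models a)\in[0,1]$, such that: (1) $gr(x\models a)\wedge R(a,b)\le gr(x\models b)$; (2) $gr(x\models\bigwedge S)=\inf\{gr(x\models a)\mid a\in S\}$ for every finite subset $S$ of $A$, including the empty set; (3) $gr(x\models\bigvee S)=\sup\{gr(x\models a)\mid a\in S\}$ for every $S\subseteq A$. The category $\mathbf{Graded\ Fuzzy\ TopSys}$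 has these as objects; a morphism $(f_1,f_2):(X,\models,A,R)\to(Y,\models',B,R')$ consists of a function $f_1:X\to Y$ and a graded frame homomorphism $f_2:(B,R')\to(A,R)$ with $gr(x\models f_2(b))=gr(f_1(x)\models' b)$ for all $x\in X$, $b\in B$. Identities are $(id_X,id_A)$ and composition is $(g_1,g_2)\circ(f_1,f_2)=(g_1\circ f_1,f_2\circ g_2)$. Functors. (a) $Ext_g:\mathbf{Graded\ Fuzzy\ TopSys}\to\mathbf{Graded\ Fuzzy\ Top}$: $Ext_g(X,\models,A,R)=(X,ext_g(A),\subseteq)$ with $ext_g(A)=\{ext_g(a)\mid a\in A\}$, $ext_g(a)(x)=gr(x\models a)$; $Ext_g(f_1,f_2)=f_1$. (b) $J_g:\mathbf{Graded\ Fuzzy\ Top}\to\mathbf{Graded\ Fuzzy\ TopSys}$: $J_g(X,\tau,\subseteq)=(X,\in,\tau,\subseteq)$, where $gr(x\in\tilde T)=\tilde T(x)$ for $\tilde T\in\tau$ and $\tau$ is the graded frame with top $\tilde X$, meet $\cap$, join $\bigcup$ and relation $gr(\cdot\subseteq\cdot)$; $J_g(f)=(f,f^{-1})$. (c) $fm_g:\mathbf{Graded\ Fuzzy\ TopSys}\to\mathbf{Graded\ Frm}^{op}$: $fm_g(X,\models,A,R)=(A,R)$, $fm_g(f_1,f_2)=f_2$. (d) $S_g:\mathbf{Graded\ Frm}^{op}\to\mathbf{Graded\ Fuzzy\ TopSys}$: let $R^*(a,b)=a\rightarrow b$ on $[0,1]$ (Gödel arrow); $([0,1],R^* )$ is regarded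 as a graded frame with top $1$, meet $\min$ and join $\sup$. Let $Hom_g((A,R),([0,1],R^* ))$ be the set of graded frame homomorphisms $v:(A,R)\to([0,1],R^* )$. Then $S_g((A,R))=(Hom_g((A,R),([0,1],R^* )),\models_*,A,R)$ with $gr(v\models_* a)=v(a)$, and for a graded frame homomorphism $f:(B,R')\to(A,R)$, $S_g(f)=(\_\circ f,f)$, where $\_\circ f$ sends $v$ to $v\circ f$.
   Formalization: Graded frame homomorphisms are also required to preserve the top (otherwise the constant map 0 is a point and S_g violates the empty-meet axiom), and the point set of a graded fuzzy topological system may be empty, so that J_g and S_g are defined on all objects. *)

(* Defs.v *)
From mathcomp Require Import all_boot all_order all_algebra.
From mathcomp Require Import interval_inference all_classical all_reals.

Set Implicit Arguments.
Unset Strict Implicit.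
Unset Printing Implicit Defensive.

Import Order.TTheory GRing.Theory Num.Theory.
Local Open Scope classical_set_scope.
Local Open Scope ring_scope.

(** * Categories, functors, adjunctions *)

Record category := Category {
  obj :> Type;
  mor : obj -> obj -> Type;
  idm : forall a, mor a a;
  cmp : forall a b c, mor b c -> mor a b -> mor a c;
  cmp1m : forall a b (f : mor a b), cmp (idm b) f = f;
  cmpm1 : forall a b (f : mor a b), cmp f (idm a) = f;
  cmpA : forall a b c d (h : mor c d) (g : mor b c) (f : mor a b),
    cmp h (cmp g f) = cmp (cmp h g) f
}.

Arguments mor {c} _ _ : rename.
Arguments idm {c} _ : rename.
Arguments cmp {c a b c0} _ _ : rename.

Definition op (C : category) : category :=
  @Category C (fun a b => @mor C b a) (fun a => idm a)
    (fun _ _ _ g f => cmp f g)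
    (fun _ _ f => cmpm1 f) (fun _ _ f => cmp1m f)
    (fun _ _ _ _ h g f => esym (cmpA f g h)).

Record functor (C D : category) := Functor {
  fobj :> C -> D;
  fmor : forall a b : C, mor a b -> mor (fobj a) (fobj b);
  fmor1 : forall a : C, fmor (idm a) = idm (fobj a);
  fmorM : forall (a b c : C) (g : mor b c) (f : mor a b),
    fmor (cmp g f) = cmp (fmor g) (fmor f)
}.

Arguments fmor {C D} _ {a b} _ : rename.

Section FunctorComp.
Variables (C D E : category) (G : functor D E) (F : functor C D).

Let fc_map (a b : C) (f : mor a b) : mor (G (F a)) (G (F b)) :=
  fmor G (fmor F f).

Let fc_map1 (a : C) : fc_map (idm a) = idm (G (F a)).
Proof. by rewrite /fc_map !fmor1. Qed.

Let fc_mapM (a b c : C) (g : mor b c) (f : mor a b) :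
  fc_map (cmp g f) = cmp (fc_map g) (fc_map f).
Proof. by rewrite /fc_map !fmorM. Qed.

Definition functor_comp : functor C E :=
  @Functor C E (fun a => G (F a)) fc_map fc_map1 fc_mapM.

End FunctorComp.

(** [G] is right adjoint to [F]: bijections [mor (F c) d ~ mor c (G d)],
    natural in [c] and [d]. *)
Definition is_right_adjoint (C D : category)
    (G : functor D C) (F : functor C D) : Prop :=
  exists phi : forall (c : C) (d : D), mor (F c) d -> mor c (G d),
    [/\ forall c d, bijective (@phi c d),
        forall (c c' : C) (d : D) (f : mor c' c) (g : mor (F c) d),
          phi c' d (cmp g (fmor F f)) = cmp (phi c d g) f
      & forall (c : C) (d d' : D) (h : mor d d') (g : mor (F c) d),
          phi c d' (cmp h g) = cmp (fmor G h) (phi c d g)].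

Lemma eq_sval (T : Type) (P : T -> Prop) (u v : {x | P x}) :
  sval u = sval v -> u = v.
Proof. by case: u v => u pu [v pv] /= e; exact: eq_exist. Qed.

(** * Grades in [0, 1] *)

Section Grades.
Variable R : realType.
Local Notation I := {i01 R}.
Implicit Types (a b c : I) (S : set I).

Definition grade0 : I := Itv01 (lexx 0) ler01.
Definition grade1 : I := Itv01 ler01 (lexx 1).

Lemma grade_ge0 a : grade0 <= a.
Proof. by case: a => x /= h; rewrite -num_le /=; case/and3P: h. Qed.

Lemma grade_le1 a : a <= grade1.
Proof. by case: a => x /= h; rewrite -num_le /=; case/and3P: h. Qed.

Let ub1 S : has_ubound [set x%:num | x in S].
Proof. by exists 1 => _ [x Sx <-]; exact: (grade_le1 x). Qed.

Let lb0 S : has_lbound (1 |` [set x%:num | x in S]).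
Proof.
by exists 0 => _ [->|[x Sx <-]]; [exact: ler01 | exact: (grade_ge0 x)].
Qed.

Let sup_ge0 S : 0 <= sup [set x%:num | x in S].
Proof.
have [->|/set0P[x Sx]] := eqVneq S set0; first by rewrite image_set0 sup0.
apply: (@le_trans _ _ x%:num); first exact: (grade_ge0 x).
apply: (ub_le_sup (ub1 S)).
by exists x.
Qed.

Let sup_le1 S : sup [set x%:num | x in S] <= 1.
Proof.
have [->|/set0P[x Sx]] := eqVneq S set0.
  by rewrite image_set0 sup0 ler01.
apply: ge_sup; first by exists x%:num, x.
by move=> _ [y Sy <-]; exact: (grade_le1 y).
Qed.

Let inf_ge0 S : 0 <= inf (1 |` [set x%:num | x in S]).
Proof.
apply: lb_le_inf; first by exists 1; left.
by move=> _ [->|[x Sx <-]]; [exact: ler01 | exact: (grade_ge0 x)].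
Qed.

Let inf_le1 S : inf (1 |` [set x%:num | x in S]) <= 1.
Proof. by apply: (ge_inf (lb0 S)); left. Qed.

(** Bounds are taken in [0, 1], so the empty set has supremum 0 and
    infimum 1. *)
Definition gsup S : I := Itv01 (sup_ge0 S) (sup_le1 S).
Definition ginf S : I := Itv01 (inf_ge0 S) (inf_le1 S).

Lemma gsup_leP S b : gsup S <= b <-> (forall a, S a -> a <= b).
Proof.
split=> [h a Sa|h].
  apply: le_trans h; rewrite -num_le; apply: (ub_le_sup (ub1 S)).
  by exists a.
rewrite -num_le /=.
have [->|/set0P[x Sx]] := eqVneq S set0.
  by rewrite image_set0 sup0; exact: (grade_ge0 b).
apply: ge_sup; first by exists x%:num, x.
by move=> _ [y Sy <-]; rewrite num_le; exact: h.
Qed.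

Lemma le_gsup S a : S a -> a <= gsup S.
Proof. by move=> Sa; have /gsup_leP := lexx (gsup S); apply. Qed.

Lemma le_ginfP S b : b <= ginf S <-> (forall a, S a -> b <= a).
Proof.
split=> [h a Sa|h].
  apply: (le_trans h); rewrite -num_le; apply: (ge_inf (lb0 S)).
  by right; exists a.
rewrite -num_le /=; apply: lb_le_inf; first by exists 1; left.
move=> _ [->|[x Sx <-]]; first exact: (grade_le1 b).
by rewrite num_le; exact: h.
Qed.

(** The Gödel arrow. *)
Definition arrow a b : I := if a <= b then grade1 else b.

Lemma le_arrow a b c : (c <= arrow a b) = (Num.min c a <= b).
Proof.
rewrite /arrow; case: (leP a b) => ab.
  by rewrite grade_le1 ge_min ab orbT.
by rewrite ge_min [a <= b]leNgt ab orbF.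
Qed.

Lemma grade_eqP a b : (forall c, c <= a <-> c <= b) -> a = b.
Proof.
by move=> h; apply/le_anti/andP; split; [apply/h | apply/h].
Qed.

Lemma grade1P a : (forall c, c <= a) -> a = grade1.
Proof. by move=> h; apply/le_anti; rewrite grade_le1 h. Qed.

Lemma arrow_eq1 a b : arrow a b = grade1 <-> a <= b.
Proof.
split=> [h|ab]; last by rewrite /arrow ab.
have : grade1 <= arrow a b by rewrite h.
by rewrite le_arrow; apply: le_trans; rewrite le_min grade_le1 lexx.
Qed.

End Grades.

(** * Graded frames *)

Record gframe (R : realType) := GFrame {
  gf_car :> Type;
  gf_top : gf_car;
  gf_meet : gf_car -> gf_car -> gf_car;
  gf_join : set gf_car -> gf_car;
  gf_rel : gf_car -> gf_car -> {i01 R};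
  gf_refl : forall a, gf_rel a a = grade1 R;
  gf_anti : forall a b,
    gf_rel a b = grade1 R -> gf_rel b a = grade1 R -> a = b;
  gf_trans : forall a b c, Num.min (gf_rel a b) (gf_rel b c) <= gf_rel a c;
  gf_meetl : forall a b, gf_rel (gf_meet a b) a = grade1 R;
  gf_meetr : forall a b, gf_rel (gf_meet a b) b = grade1 R;
  gf_le_top : forall a, gf_rel a gf_top = grade1 R;
  gf_le_meet : forall a b c,
    Num.min (gf_rel a b) (gf_rel a c) = gf_rel a (gf_meet b c);
  gf_le_join : forall a (S : set gf_car),
    S a -> gf_rel a (gf_join S) = grade1 R;
  gf_join_le : forall (S : set gf_car) b,
    ginf [set gf_rel a b | a in S] = gf_rel (gf_join S) b;
  gf_distr : forall a (S : set gf_car),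
    gf_rel (gf_meet a (gf_join S)) (gf_join [set gf_meet a b | b in S])
      = grade1 R
}.

Arguments gf_top {R} _.

(** Homomorphisms preserve all finite meets, the empty one (the top) included.
    Preservation of the top does not follow from the other clauses (the map
    [a |-> 0] into [0, 1] satisfies them), and without it the points of a frame
    would not form a system: the empty meet would not have grade 1. *)
Record ghom (R : realType) (A B : gframe R) := GHom {
  gh_fun :> A -> B;
  gh_top : gh_fun (gf_top A) = gf_top B;
  gh_meet : forall a b,
    gh_fun (gf_meet a b) = gf_meet (gh_fun a) (gh_fun b);
  gh_join : forall S : set A, gh_fun (gf_join S) = gf_join (gh_fun @` S);
  gh_rel : forall a b, gf_rel a b <= gf_rel (gh_fun a) (gh_fun b)
}.

Lemma ghom_eq (R : realType) (A B : gframe R) (f g : ghom A B) :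
  (f : A -> B) = g -> f = g.
Proof.
case: f => f f1 f2 f3 f4; case: g => g g1 g2 g3 g4 /= e.
by subst g; congr GHom; exact: Prop_irrelevance.
Qed.

Section GFrm.
Variable R : realType.

Let idh (A : gframe R) : ghom A A.
Proof. by exists idfun => // S; rewrite image_id. Defined.

Let comph (A B C : gframe R) (g : ghom B C) (f : ghom A B) : ghom A C.
Proof.
exists (g \o f) => [|a b|S|a b] /=.
- by rewrite !gh_top.
- by rewrite !gh_meet.
- by rewrite !gh_join -image_comp.
- exact: le_trans (gh_rel f a b) (gh_rel g _ _).
Defined.

Definition GFrm : category.
Proof.
by refine (@Category (gframe R) (@ghom R) idh comph _ _ _) => *; exact: ghom_eq.
Defined.

End GFrm.

(** * Fuzzy topological spaces with graded inclusion *)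

(** The fuzzy inclusion is determined by the set of points, hence is not a field
    of [gspace]. *)
Definition incl (R : realType) (X : Type) (T1 T2 : X -> {i01 R}) : {i01 R} :=
  ginf (range (fun x => arrow (T1 x) (T2 x))).

Definition fcap (R : realType) (X : Type) (T1 T2 : X -> {i01 R}) :
    X -> {i01 R} :=
  fun x => Num.min (T1 x) (T2 x).

Definition fcup (R : realType) (X : Type) (F : set (X -> {i01 R})) :
    X -> {i01 R} :=
  fun x => gsup [set T x | T in F].

Record gspace (R : realType) := GSpace {
  gt_pt :> Type;
  gt_open : set (gt_pt -> {i01 R});
  gt_open0 : gt_open (fun=> grade0 R);
  gt_open1 : gt_open (fun=> grade1 R);
  gt_openU : forall F, F `<=` gt_open -> gt_open (fcup F);
  gt_openI : forall T1 T2, gt_open T1 -> gt_open T2 -> gt_open (fcap T1 T2)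
}.

Record gcont (R : realType) (X Y : gspace R) := GCont {
  gc_fun :> X -> Y;
  gc_open : forall T, gt_open T -> gt_open (T \o gc_fun)
}.

Lemma gcont_eq (R : realType) (X Y : gspace R) (f g : gcont X Y) :
  (f : X -> Y) = g -> f = g.
Proof.
case: f => f f1; case: g => g g1 /= e.
by subst g; congr GCont; exact: Prop_irrelevance.
Qed.

Section GTop.
Variable R : realType.

Let idc (X : gspace R) : gcont X X.
Proof. by exists idfun. Defined.

Let compc (X Y Z : gspace R) (g : gcont Y Z) (f : gcont X Y) : gcont X Z.
Proof. by exists (g \o f) => T oT; exact: (gc_open f (gc_open g oT)). Defined.

Definition GTop : category.
Proof.
by refine (@Category (gspace R) (@gcont R) idc compc _ _ _) => *;
  exact: gcont_eq.
Defined.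

End GTop.

(** * Graded fuzzy topological systems *)

(** The finite subsets of the frame are the ranges of its finite families, the
    empty one included.  The set of points is not required to be inhabited: [Jg]
    sends the empty space to a system without points, and so does [Sg] for a
    frame without homomorphisms to [0, 1], such as the one-element frame. *)
Record gsystem (R : realType) := GSystem {
  gs_pt : Type;
  gs_frm : gframe R;
  gs_sat : gs_pt -> gs_frm -> {i01 R};
  gs_sat_rel : forall x a b, Num.min (gs_sat x a) (gf_rel a b) <= gs_sat x b;
  gs_sat_meet : forall x n (a : 'I_n -> gs_frm),
    gs_sat x (\big[@gf_meet R gs_frm/gf_top gs_frm]_(i < n) a i) =
    ginf [set gs_sat x b | b in range a];
  gs_sat_join : forall x (S : set gs_frm),
    gs_sat x (gf_join S) = gsup [set gs_sat x a | a in S]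
}.

Record gsysmap (R : realType) (X Y : gsystem R) := GSysmap {
  gm_pt : gs_pt X -> gs_pt Y;
  gm_frm : ghom (gs_frm Y) (gs_frm X);
  gm_sat : forall x b, gs_sat x (gm_frm b) = gs_sat (gm_pt x) b
}.

Lemma gsysmap_eq (R : realType) (X Y : gsystem R) (f g : gsysmap X Y) :
  gm_pt f = gm_pt g -> gm_frm f = gm_frm g -> f = g.
Proof.
case: f => f1 f2 f3; case: g => g1 g2 g3 /= e1 e2.
by subst g1 g2; congr GSysmap; exact: Prop_irrelevance.
Qed.

Section GTopSys.
Variable R : realType.

Let ids (X : gsystem R) : gsysmap X X :=
  @GSysmap R X X idfun (idm (gs_frm X : GFrm R)) (fun _ _ => erefl).

Let comps (X Y Z : gsystem R) (g : gsysmap Y Z) (f : gsysmap X Y) :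
  gsysmap X Z.
Proof.
exists (gm_pt g \o gm_pt f)
  (@cmp (GFrm R) _ _ _ (gm_frm f) (gm_frm g)) => x b /=.
by rewrite !gm_sat.
Defined.

Definition GTopSys : category.
Proof.
refine (@Category (gsystem R) (@gsysmap R) ids comps _ _ _) => *;
  by apply: gsysmap_eq => //; exact: ghom_eq.
Defined.

End GTopSys.

(** * The functors *)

Section Functors.
Variable R : realType.
Local Notation I := {i01 R}.

Lemma gs_sat_top (X : gsystem R) (x : gs_pt X) :
  gs_sat x (gf_top (gs_frm X)) = grade1 R.
Proof.
have := @gs_sat_meet R X x 0 (fun=> gf_top _); rewrite big_ord0 => ->.
by apply: grade1P => c; apply/le_ginfP => d [b [i _ _] _]; case: i.
Qed.

Lemma gs_sat_meet2 (X : gsystem R) (x : gs_pt X) (a b : gs_frm X) :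
  gs_sat x (gf_meet a b) = Num.min (gs_sat x a) (gs_sat x b).
Proof.
have mT (c : gs_frm X) : gf_meet c (gf_top _) = c.
  apply: gf_anti; first exact: gf_meetl.
  by rewrite -gf_le_meet gf_refl gf_le_top minxx.
have := @gs_sat_meet R X x 2 (fun i => if val i == 0 then a else b).
rewrite !big_ord_recl big_ord0 /= mT => ->.
apply: grade_eqP => c; split.
  move/le_ginfP => h; rewrite le_min; apply/andP; split; apply: h.
    by exists a => //; exists ord0.
  by exists b => //; exists (lift ord0 ord0).
rewrite le_min => /andP[ca cb]; apply/le_ginfP => _ [d [i _ <-] <-].
by case: ifP.
Qed.

(** ** Extent *)

Definition ext (X : gsystem R) (a : gs_frm X) : gs_pt X -> I :=
  fun x => gs_sat x a.

Definition Ext_space (X : gsystem R) : gspace R.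
Proof.
exists (gs_pt X) (range (@ext X)).
- exists (gf_join set0) => //; apply/funext => x; rewrite /ext gs_sat_join.
  by apply/le_anti; rewrite grade_ge0 andbT; apply/gsup_leP => _ [b []].
- by exists (gf_top _) => //; apply/funext => x; exact: gs_sat_top.
- move=> F FX; exists (gf_join [set a | F (ext a)]) => //.
  apply/funext => x; rewrite /ext gs_sat_join /fcup; congr gsup.
  apply/seteqP; split => _ [a Fa <-]; first by exists (ext a).
  have [b _ e] := FX _ Fa; by exists b; [move: Fa; rewrite -e | rewrite -e].
- move=> _ _ [a _ <-] [b _ <-]; exists (gf_meet a b) => //.
  by apply/funext => x; exact: gs_sat_meet2.
Defined.

Definition Ext_map (X Y : gsystem R) (f : gsysmap X Y) :
  gcont (Ext_space X) (Ext_space Y).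
Proof.
exists (gm_pt f) => _ [b _ <-]; exists (gm_frm f b) => //.
by apply/funext => x; exact: gm_sat.
Defined.

Definition Extg : functor (GTopSys R) (GTop R).
Proof.
by refine (@Functor (GTopSys R) (GTop R) Ext_space Ext_map _ _) => *;
  exact: gcont_eq.
Defined.

(** ** Spaces as systems *)

Section OpenFrame.
Variable X : gspace R.
Local Notation tau := {T : X -> I | gt_open T}.

Definition tau_top : tau := exist _ _ (gt_open1 X).

Definition tau_meet (T1 T2 : tau) : tau :=
  exist _ _ (gt_openI (svalP T1) (svalP T2)).

Definition tau_join (F : set tau) : tau.
Proof.
exists (fcup [set sval T | T in F]).
by apply: gt_openU => _ [T _ <-]; exact: svalP.
Defined.

Definition tau_rel (T1 T2 : tau) : I := incl (sval T1) (sval T2).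

Lemma le_incl (T1 T2 : X -> I) c :
  c <= incl T1 T2 <-> forall x, Num.min c (T1 x) <= T2 x.
Proof.
split=> [/le_ginfP h x|h]; first by rewrite -le_arrow; apply: h; exists x.
by apply/le_ginfP => _ [x _ <-]; rewrite le_arrow.
Qed.

Lemma incl_eq1 (T1 T2 : X -> I) :
  incl T1 T2 = grade1 R <-> forall x, T1 x <= T2 x.
Proof.
split=> [h x|h].
  have /le_incl/(_ x) : grade1 R <= incl T1 T2 by rewrite h.
  by apply: le_trans; rewrite le_min grade_le1 lexx.
apply: grade1P => c; apply/le_incl => x.
by apply: le_trans (h x); rewrite ge_min lexx orbT.
Qed.

Definition Omega : gframe R.
Proof.
refine (@GFrame R tau tau_top tau_meet tau_join tau_rel _ _ _ _ _ _ _ _ _ _).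
- by move=> a; apply/incl_eq1.
- move=> a b /incl_eq1 ab /incl_eq1 ba; apply: eq_sval; apply/funext => x.
  by apply/le_anti; rewrite ab ba.
- move=> a b c; apply/le_incl => x.
  have /le_incl/(_ x) ab := lexx (tau_rel a b).
  have /le_incl/(_ x) bc := lexx (tau_rel b c).
  apply: le_trans bc; rewrite le_min; apply/andP; split.
    by rewrite !ge_min lexx !orbT.
  apply: le_trans ab; rewrite le_min !ge_min !lexx !orbT andbT.
  by [].
- by move=> a b; apply/incl_eq1 => x; rewrite /= /fcap ge_min lexx.
- by move=> a b; apply/incl_eq1 => x; rewrite /= /fcap ge_min lexx orbT.
- by move=> a; apply/incl_eq1 => x; exact: grade_le1.
- move=> a b c; apply: grade_eqP => d; rewrite le_min; split.
    move=> /andP[/le_incl ab /le_incl ac]; apply/le_incl => x.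
    by rewrite /= /fcap le_min ab ac.
  move/le_incl => h; apply/andP; split; apply/le_incl => x; move: (h x);
    by rewrite /= /fcap le_min => /andP[].
- move=> a S Sa; apply/incl_eq1 => x; rewrite /= /fcup.
  by apply: le_gsup; exists (sval a) => //; exists a.
- move=> S b; apply: grade_eqP => c; split.
    move/le_ginfP => h; apply/le_incl => x; rewrite minC -le_arrow.
    apply/gsup_leP => _ [_ [T ST <-] <-]; rewrite le_arrow minC.
    by have /le_incl := h _ (ex_intro2 _ _ T ST erefl); apply.
  move/le_incl => h; apply/le_ginfP => _ [T ST <-]; apply/le_incl => x.
  have /gsup_leP h' : fcup [set sval T | T in S] x <= arrow c (sval b x).
    by rewrite le_arrow minC; exact: h.
  rewrite minC -le_arrow; apply: h'.
  exists (sval T) => //.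
  by exists T.
- move=> a S; apply/incl_eq1 => x; rewrite /= {1}/fcap minC -le_arrow.
  apply/gsup_leP => _ [_ [T ST <-] <-]; rewrite le_arrow minC.
  apply: le_gsup; exists (fcap (sval a) (sval T)) => //.
  by exists (tau_meet a T) => //; exists T.
Defined.

Definition J_system : gsystem R.
Proof.
refine (@GSystem R X Omega (fun x (T : Omega) => sval T x) _ _ _).
- by move=> x a b; rewrite minC; apply: (le_incl _ _ _).1.
- move=> x n a; apply: grade_eqP => c.
  have -> : (c <= sval (\big[@gf_meet R Omega/gf_top Omega]_(i < n) a i) x) <->
      forall i, c <= sval (a i) x.
    elim: n a => [|n IH] a.
      by rewrite big_ord0; split=> [_ []//|_]; exact: grade_le1.
    rewrite big_ord_recl /= /fcap le_min; split.
      move=> /andP[c0 /IH cS] i.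
      by case: (unliftP ord0 i) => [j|] ->.
    by move=> h; rewrite h /=; apply/IH => i.
  split=> [h|/le_ginfP h i].
    by apply/le_ginfP => _ [_ [i _ <-] <-].
  by apply: h; exists (a i) => //; exists i.
- by move=> x S; rewrite /= /fcup; congr gsup; rewrite image_comp.
Defined.

End OpenFrame.

Definition preim_open (X Y : gspace R) (f : gcont X Y) (T : Omega Y) :
    Omega X :=
  exist _ _ (gc_open f (svalP T)).

Definition Omega_map (X Y : gspace R) (f : gcont X Y) :
  ghom (Omega Y) (Omega X).
Proof.
exists (preim_open f).
- exact: eq_sval.
- by move=> a b; exact: eq_sval.
- move=> S; apply: eq_sval; apply/funext => x /=; rewrite /fcup.
  by congr gsup; rewrite !image_comp.
- move=> a b; apply/le_incl => x /=.
  by have /le_incl := lexx (tau_rel a b); apply.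
Defined.

Definition J_map (X Y : gspace R) (f : gcont X Y) :
  gsysmap (J_system X) (J_system Y) :=
  @GSysmap R (J_system X) (J_system Y) f (Omega_map f) (fun _ _ => erefl).

Definition Jg : functor (GTop R) (GTopSys R).
Proof.
refine (@Functor (GTop R) (GTopSys R) J_system J_map _ _) => *;
  apply: gsysmap_eq => //; apply: ghom_eq; apply/funext => T; exact: eq_sval.
Defined.

(** ** The underlying frame of a system *)

Definition fmg : functor (GTopSys R) (op (GFrm R)) :=
  @Functor (GTopSys R) (op (GFrm R)) (fun X => gs_frm X)
    (fun X Y f => gm_frm f) (fun _ => erefl) (fun _ _ _ _ _ => erefl).

(** ** The system of points of a frame *)

Definition grade_frame : gframe R.
Proof.
refine (@GFrame R I (grade1 R) Num.min (@gsup R) (@arrow R)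
  _ _ _ _ _ _ _ _ _ _).
- by move=> a; apply/arrow_eq1.
- by move=> a b /arrow_eq1 ab /arrow_eq1 ba; apply/le_anti; rewrite ab ba.
- move=> a b c; rewrite le_arrow.
  have := lexx (arrow a b); rewrite le_arrow => ab.
  have := lexx (arrow b c); rewrite le_arrow; apply: le_trans.
  rewrite le_min; apply/andP; split; first by rewrite !ge_min lexx !orbT.
  by apply: le_trans ab; rewrite le_min !ge_min !lexx !orbT.
- by move=> a b; apply/arrow_eq1; rewrite ge_min lexx.
- by move=> a b; apply/arrow_eq1; rewrite ge_min lexx orbT.
- by move=> a; apply/arrow_eq1; exact: grade_le1.
- move=> a b c; apply: grade_eqP => d.
  by rewrite le_min !le_arrow [X in _ <-> is_true X]le_min.
- by move=> a S Sa; apply/arrow_eq1; exact: le_gsup.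
- move=> S b; apply: grade_eqP => c; rewrite le_arrow minC -le_arrow; split.
    move/le_ginfP => h; apply/gsup_leP => a Sa.
    by rewrite le_arrow minC -le_arrow; apply: h; exists a.
  move/gsup_leP => h; apply/le_ginfP => _ [a Sa <-].
  by rewrite le_arrow minC -le_arrow; exact: h.
- move=> a S; apply/arrow_eq1; rewrite minC -le_arrow; apply/gsup_leP => b Sb.
  rewrite le_arrow minC; apply: le_gsup.
  by exists b.
Defined.

Definition S_system (A : gframe R) : gsystem R.
Proof.
refine (@GSystem R (ghom A grade_frame) A (fun v a => v a) _ _ _).
- by move=> v a b; rewrite minC -le_arrow; exact: (gh_rel v).
- move=> v n a; apply: grade_eqP => c.
  have -> : (c <= (v (\big[@gf_meet R A/gf_top A]_(i < n) a i) : I)) <->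
      forall i, c <= (v (a i) : I).
    elim: n a => [|n IH] a.
      by rewrite big_ord0 gh_top; split=> [_ []//|_]; exact: grade_le1.
    rewrite big_ord_recl gh_meet /= le_min; split.
      move=> /andP[c0 /IH cS] i.
      by case: (unliftP ord0 i) => [j|] ->.
    by move=> h; rewrite h /=; apply/IH => i.
  split=> [h|/le_ginfP h i].
    by apply/le_ginfP => _ [_ [i _ <-] <-].
  by apply: h; exists (a i) => //; exists i.
- by move=> v S; exact: (gh_join v S).
Defined.

(** A morphism [A -> B] of the opposite category is a homomorphism from [B] to
    [A]. *)
Definition S_map (A B : gframe R) (f : ghom B A) :
  gsysmap (S_system A) (S_system B) :=
  @GSysmap R (S_system A) (S_system B)
    (fun v : ghom A grade_frame => @cmp (GFrm R) B A grade_frame v f) f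
    (fun _ _ => erefl).

Definition Sg : functor (op (GFrm R)) (GTopSys R).
Proof.
refine (@Functor (op (GFrm R)) (GTopSys R) S_system S_map _ _) => *;
  by apply: gsysmap_eq => //; apply/funext => v; exact: ghom_eq.
Defined.

End Functors.

(* Main.v *)
(** A graded frame homomorphism from [A] to the opens of [X] is the same thing
    as a continuous map from [X] to the points of [A]: both curry the graded
    relation [(x, a) |-> f a x] between [X] and [A]. *)
Require Import Defs.
From mathcomp Require Import all_boot all_order all_algebra.
From mathcomp Require Import interval_inference all_classical all_reals.

Set Implicit Arguments.
Unset Strict Implicit.
Unset Printing Implicit Defensive.

Import Order.TTheory.

(** Each point of a system is a homomorphism to [0, 1]: since [Num.min] is residuated by [arrow],
    compatibility of satisfaction with the relation becomes [gh_rel]. *)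
Definition sat_ghom (R : realType) (Y : gsystem R) (y : gs_pt Y) :
  ghom (gs_frm Y) (grade_frame R).
Proof.
exists (gs_sat y).
- exact: gs_sat_top.
- exact: gs_sat_meet2.
- exact: gs_sat_join.
- by move=> a b; rewrite /= le_arrow minC; exact: gs_sat_rel.
Defined.

Section Transpose.
Variables (R : realType) (X : gspace R) (A : gframe R).

Definition transpose (f : ghom A (Omega X)) : gcont X (Ext_space (S_system A)).
Proof.
exists (fun x => @cmp (GFrm R) A (Omega X) (grade_frame R)
                   (@sat_ghom R (J_system X) x) f).
(* The preimage of the extent of [a] is the open set [f a] itself. *)
by move=> _ [a _ <-]; exact: svalP (f a).
Defined.

(** This is [x |-> g x a], open as the preimage under [g] of the extent of [a]. *)
Definition untranspose_fun (g : gcont X (Ext_space (S_system A))) (a : A) :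
    Omega X :=
  exist _ _ (gc_open g (ex_intro2 _ _ a I erefl)).

Definition untranspose (g : gcont X (Ext_space (S_system A))) :
  ghom A (Omega X).
Proof.
exists (untranspose_fun g).
- by apply: eq_sval; apply/funext => x; exact: (gh_top (g x)).
- by move=> a b; apply: eq_sval; apply/funext => x; exact: (gh_meet (g x)).
- move=> S; apply: eq_sval; apply/funext => x /=; rewrite /fcup !image_comp.
  exact: (gh_join (g x)).
(* Inclusion is an infimum over points, so the bound given by each [g x] suffices. *)
- move=> a b; apply/le_incl => x; rewrite minC.
  by have := gh_rel (g x) a b; rewrite /= le_arrow minC.
Defined.

Lemma transposeK : cancel transpose untranspose.
Proof. by move=> f; apply: ghom_eq; apply/funext => a; exact: eq_sval. Qed.

Lemma untransposeK : cancel untranspose transpose.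
Proof. by move=> g; apply: gcont_eq; apply/funext => x; exact: ghom_eq. Qed.

End Transpose.

Theorem theorem4p2 (R : realType) :
  is_right_adjoint (functor_comp (Extg R) (Sg R)) (functor_comp (fmg R) (Jg R)).
Proof.
exists (@transpose R); split.
- by move=> X A; exists (@untranspose R X A);
    [exact: transposeK | exact: untransposeK].
(* Both sides send [x] and [a] to the grade of [g a] at [f x]. *)
- by move=> X X' A f g; apply: gcont_eq; apply/funext => x; exact: ghom_eq.
- by move=> X A A' h g; apply: gcont_eq; apply/funext => x; exact: ghom_eq.
Qed.
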